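(* Suppose $L_i\in L(M_i)$ and $L_i\to L_\infty\notin L(M)$, where $M$ is the Gromov–Hausdorff limit of the compact length spaces $M_i$. Then the closed geodesics $\gamma_i:S^1\to M_i$ of length $L(\gamma_i)=L_i$ have $\mathrm{minind}(\gamma_i)$ diverging to infinity.
   Context: A compact length space is a compact metric space in which every pair of points is joined by a length minimizing rectifiable curve whose length equals the distance between the points. $S^1=\mathbb{R}/2\pi\mathbb{Z}$. A closed geodesic in a compact length space $M$ is a nonconstant map $\gamma:S^1\to M$ that is locally length minimizing around every point of $S^1$, parametrized proportionally to arclength with speed $L(\gamma)/(2\pi)$, where $L(\gamma)$ is its length. The length spectrum $L(M)$ is the set of lengths of closed geodesics in $M$. A $1/k$ geodesic is a closed geodesic $\gamma$ with $d(\gamma(t),\gamma(t+2\pi/k))=L(\gamma)/k$ for all $t\in S^1$. The minimizing index $\mathrm{minind}(\gamma)$ of a closed geodesic $\gamma$ is the smallest $k\in\mathbb{N}$ such that $\gamma$ is a $1/k$ geodesic (such a $k$ always exists). $M$ is the Gromov–Hausdorff limit of the $M_i$ if $d_{GH}(M_i,M)\to 0$, where $d_{GH}$ is the Gromov–Hausdorff distance between compact metric spaces.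
   Formalization: The formal theorem additionally assumes that the limit length L_∞ is nonzero; for L_∞ = 0 the claim fails, e.g. for circles of length 1/i collapsing to a point, where minind(γ_i) = 2 for all i although 0 is not in L(M). *)

(* Defs.v *)
From HB Require Import structures.
From mathcomp Require Import all_boot all_order all_algebra.
From mathcomp Require Import all_classical all_reals all_analysis.

Set Implicit Arguments.
Unset Strict Implicit.
Unset Printing Implicit Defensive.

Import Order.TTheory GRing.Theory Num.Theory.
Import numFieldTopology.Exports.

Local Open Scope classical_set_scope.
Local Open Scope ring_scope.
Local Open Scope quotient_scope.

(* Valued in \bar R, so that an empty and a nonempty set are at distance +oo *)
Definition hausdorff_dist (R : realType) (Z : metricType R) (A B : set Z) :
    \bar R :=
  ereal_inf [set r%:E | r in [set r : R | [/\ 0 < r,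
    forall x, A x -> exists2 y, B y & mdist x y < r &
    forall y, B y -> exists2 x, A x & mdist x y < r]]].

Definition isometric_embedding (R : realType) (X Z : metricType R)
    (f : X -> Z) : Prop :=
  forall x y, mdist (f x) (f y) = mdist x y.

Definition GH_dist (R : realType) (X Y : metricType R) : \bar R :=
  ereal_inf [set d | exists (Z : metricType R) (f : X -> Z) (g : Y -> Z),
    [/\ isometric_embedding f, isometric_embedding g &
        d = hausdorff_dist (range f) (range g)]].

(* The metric-space counterpart of total_variation. As itv_partition a b is
   empty when b < a, the value is meaningful for a <= b only. *)
Definition curve_length (R : realType) (M : metricType R) (a b : R)
    (c : R -> M) : \bar R :=
  ereal_sup [set (\sum_(0 <= n < size s)
                    mdist (c (nth b (a :: s) n)) (c (nth b (a :: s) n.+1)))%:E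
            | s in itv_partition a b].

Definition length_minimizing (R : realType) (M : metricType R) (a b : R)
    (c : R -> M) : Prop :=
  forall c' : R -> M, {within `[a, b], continuous c'} ->
    c' a = c a -> c' b = c b -> (curve_length a b c <= curve_length a b c')%E.

(* Rectifiability is the finiteness of the length in the last clause. *)
Definition length_space (R : realType) (M : metricType R) : Prop :=
  forall x y : M, exists c : R -> M,
    [/\ {within `[0, 1], continuous c}, c 0 = x, c 1 = y,
        length_minimizing 0 1 c & curve_length 0 1 c = (mdist x y)%:E].

Definition compact_length_space (R : realType) (M : metricType R) : Prop :=
  compact [set: M] /\ length_space M.

Definition twopiZ (R : realType) : {pred R} :=
  fun x => x / (2 * pi) \is a Num.int.
Arguments twopiZ : clear implicits.

Lemma twopiZ_zmod_closed (R : realType) : zmod_closed (twopiZ R).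
Proof.
split=> [|x y xZ yZ]; rewrite unfold_in /twopiZ; first by rewrite mul0r rpred0.
by rewrite mulrBl; exact: rpredB.
Qed.

HB.instance Definition _ (R : realType) :=
  GRing.isZmodClosed.Build R (twopiZ R) (@twopiZ_zmod_closed R).

Definition circle (R : realType) : Type := Quotient.quot (twopiZ R).

Definition circle_pi (R : realType) (t : R) : circle R :=
  \pi_(Quotient.quot (twopiZ R)) t.

Definition circle_lift (R : realType) (M : Type) (g : circle R -> M) (t : R) : M :=
  g (circle_pi t).

Definition loop_length (R : realType) (M : metricType R) (g : circle R -> M) :
    \bar R :=
  curve_length 0 (2 * pi) (circle_lift g).

Definition closed_geodesic (R : realType) (M : metricType R)
    (g : circle R -> M) : Prop :=
  [/\ continuous (circle_lift g),
      exists s t, g s <> g t,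
      forall t, exists2 e : R, 0 < e &
        length_minimizing (t - e) (t + e) (circle_lift g) &
      forall s t : R, s <= t ->
        curve_length s t (circle_lift g) =
          (loop_length g * ((2 * pi)^-1)%:E * (t - s)%:E)%E].

Definition length_spectrum (R : realType) (M : metricType R) : set R :=
  [set l | exists2 g : circle R -> M, closed_geodesic g & loop_length g = l%:E].

(* The condition 0 < k is needed: division by 0 would make every closed
   geodesic a 1/0 geodesic. *)
Definition one_over_geodesic (R : realType) (M : metricType R) (k : nat)
    (g : circle R -> M) : Prop :=
  [/\ (0 < k)%N, closed_geodesic g &
      forall t : circle R, (mdist (g t) (g (t + circle_pi (2 * pi / k%:R))))%:E =
                           (loop_length g * (k%:R^-1)%:E)%E].

(* A closed geodesic in a compact length space is a 1/k geodesic for some k, so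
   the default value 0 is not used there. *)
Definition minind (R : realType) (M : metricType R) (g : circle R -> M) : nat :=
  xget 0%N [set k | one_over_geodesic k g /\
                    forall j, one_over_geodesic j g -> (k <= j)%N].

(* Main.v *)
Require Import Defs.
From mathcomp Require Import all_boot all_order all_algebra.
From mathcomp Require Import all_classical all_reals all_analysis.
From mathcomp Require Import ring lra.
Import Order.TTheory GRing.Theory Num.Theory.
Import numFieldTopology.Exports.
Local Open Scope classical_set_scope.
Local Open Scope ring_scope.

Set Implicit Arguments.
Unset Strict Implicit.
Unset Printing Implicit Defensive.

(** The theorem is proved by contradiction.  If [minind (gamma i)] does not
    diverge, it stays below some [A] for infinitely many [i].  For these [i],
    [gamma i] stretches distances exactly by [L i / (2 * pi)] between any two
    parameters that are at most [d = 2 * pi / A] apart: a closed geodesic is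
    Lipschitz with this constant, and a Lipschitz curve that is extremal
    between two parameters is extremal between all intermediate ones
    ([linear_subsegment]).  Unlike being locally minimizing, where the size of
    the neighbourhoods may shrink with [i], this condition is uniform in [i],
    and it is a closed condition on the distances of finitely many points, so
    it survives a limit.

    The limit is taken along an ultrafilter [U] on the indices that contains
    the neighbourhoods of infinity and the set of the good [i].  Closeness in
    the Gromov-Hausdorff distance gives maps [M_ i -> M] whose distortion tends
    to [0] ([GH_cvg_almost_isometries]); as [M] is compact, the images of every
    point of the circle converge along [U], and distances converge too
    ([ultralimit]).  The ultrafilter does the work of the successive extractions
    of subsequences in the Arzela-Ascoli theorem.  The limit curve
    [q : circle R -> M] stretches distances by [Loo / (2 * pi)] between
    parameters at most [d] apart.  As [Loo] is positive, such a curve is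
    a closed geodesic of length [Loo] ([locally_linear_closed_geodesic]), so
    that [Loo] belongs to the length spectrum of [M].

    That [minind (gamma i)] bounds anything requires that [gamma i] is a
    [1/k] geodesic for at least one [k] ([ex_one_over_geodesic]).  This is a
    Lebesgue number argument on the compact interval [[0, 2 * pi]]; it is the
    place where the [M_ i] have to be length spaces. *)

(** * Lengths of curves *)

Section CurveLength.
Variables (R : realType) (M : metricType R).
Implicit Types (c : R -> M) (a b K : R) (s : seq R).

Definition inscribed_length a b c s : R :=
  \sum_(0 <= n < size s)
    mdist (c (nth b (a :: s) n)) (c (nth b (a :: s) n.+1)).

Lemma inscribed_length_nil a b c : inscribed_length a b c [::] = 0.
Proof. by rewrite /inscribed_length big_nil. Qed.

Lemma inscribed_length_cons a b c x s :
  inscribed_length a b c (x :: s) =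
  mdist (c a) (c x) + inscribed_length x b c s.
Proof. by rewrite /inscribed_length /= big_nat_recl. Qed.

Lemma mdist_le_inscribed_length a b c s : itv_partition a b s ->
  mdist (c a) (c b) <= inscribed_length a b c s.
Proof.
elim: s a => [|x s ih] a.
  by move=> /itv_partition_nil ->; rewrite mdistxx inscribed_length_nil.
move=> /itv_partition_cons/ih xb; rewrite inscribed_length_cons.
by apply: le_trans (metric_triangle _ (c x) _) _; rewrite lerD2l.
Qed.

Lemma inscribed_length_le_lipschitz a b c s K :
  (forall u v, u <= v -> mdist (c u) (c v) <= K * (v - u)) ->
  itv_partition a b s -> inscribed_length a b c s <= K * (b - a).
Proof.
move=> cK; elim: s a => [|x s ih] a abs.
  by rewrite (itv_partition_nil abs) inscribed_length_nil subrr mulr0.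
have ax : a <= x by case: abs => /= /andP[/ltW].
rewrite inscribed_length_cons.
have := lerD (cK _ _ ax) (ih _ (itv_partition_cons abs)).
by move=> /le_trans; apply; rewrite -mulrDr; lra.
Qed.

Lemma inscribed_length_comp a b c s (phi : R -> R) :
  inscribed_length (phi a) (phi b) c (map phi s) =
  inscribed_length a b (c \o phi) s.
Proof.
elim: s a => [|x s ih] a; first by rewrite !inscribed_length_nil.
by rewrite map_cons !inscribed_length_cons ih.
Qed.

Lemma inscribed_length_le_curve_length a b c s : itv_partition a b s ->
  ((inscribed_length a b c s)%:E <= curve_length a b c)%E.
Proof. by move=> abs; apply: ereal_sup_ubound; exists s. Qed.

Lemma curve_length_le a b c (l : \bar R) :
  (forall s, itv_partition a b s -> ((inscribed_length a b c s)%:E <= l)%E) ->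
  (curve_length a b c <= l)%E.
Proof. by move=> h; apply: ge_ereal_sup => _ [s abs <-]; exact: h. Qed.

Lemma mdist_le_curve_length a b c : a <= b ->
  ((mdist (c a) (c b))%:E <= curve_length a b c)%E.
Proof.
rewrite le_eqVlt => /predU1P[<-|ab].
  have p : itv_partition a a [::] by split => /=.
  by have := inscribed_length_le_curve_length c p; rewrite inscribed_length_nil mdistxx.
have p := itv_partition1 ab.
apply: le_trans (inscribed_length_le_curve_length c p).
by rewrite lee_fin mdist_le_inscribed_length.
Qed.

(** This turns a shortest path parametrized by [[0, 1]] into a competitor, on
    [[a, b]], for curves that minimize length there. *)
Lemma curve_length_affine a b c : a < b ->
  (curve_length a b (fun t => c ((t - a) / (b - a))%R) <= curve_length 0 1 c)%E.
Proof.
move=> ab; have ba0 : 0 < b - a by rewrite subr_gt0.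
pose phi t := (t - a) / (b - a).
have phia : phi a = 0 by rewrite /phi subrr mul0r.
have phib : phi b = 1 by rewrite /phi divff// gt_eqF.
apply: curve_length_le => s [sa /eqP sb].
rewrite -(inscribed_length_comp a b c s phi) phia phib.
apply: inscribed_length_le_curve_length; split.
  rewrite -phia path_map; apply: sub_path sa => x y xy /=.
  by rewrite /phi ltr_pM2r ?invr_gt0// ltrD2r.
by rewrite -phia last_map sb phib.
Qed.

(** Partitioning with mesh at most [d] makes every side of the inscribed polygon
    equal to its share [K * (v - u)], whatever happens at scales above [d]. *)
Lemma locally_linear_partition a b c K d : a <= b -> 0 < d ->
  (forall u v, u <= v -> v - u <= d -> mdist (c u) (c v) = K * (v - u)) ->
  exists2 s, itv_partition a b s & inscribed_length a b c s = K * (b - a).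
Proof.
move=> ab d0 cK.
have [n] : exists n : nat, b - a <= n%:R * d.
  exists (Num.truncn ((b - a) / d)).+1.
  by rewrite -ler_pdivrMr// ltW// truncnS_gt.
elim: n a ab => [|n ih] a ab nd.
  have -> : b = a by lra.
  exists [::]; first by split => /=.
  by rewrite inscribed_length_nil subrr mulr0.
have [bad|dba] := leP (b - a) d.
  have [<-|anb] := eqVneq a b.
    exists [::]; first by split => /=.
    by rewrite inscribed_length_nil subrr mulr0.
  exists [:: b]; first by apply: itv_partition1; rewrite lt_neqAle anb.
  by rewrite inscribed_length_cons inscribed_length_nil addr0 cK.
have [||s [ps sb] sE] := ih (a + d).
- lra.
- by move: nd; rewrite -natr1 mulrDl mul1r; lra.
exists ((a + d) :: s).
  by split => //=; rewrite ltrDl d0.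
rewrite inscribed_length_cons sE cK; lra.
Qed.

Lemma locally_linear_lipschitz a b c K d : a <= b -> 0 < d ->
  (forall u v, u <= v -> v - u <= d -> mdist (c u) (c v) = K * (v - u)) ->
  mdist (c a) (c b) <= K * (b - a).
Proof.
move=> ab d0 cK; have [s abs <-] := locally_linear_partition ab d0 cK.
exact: mdist_le_inscribed_length.
Qed.

(** The lower bound comes from one fine partition; the upper bound holds for all
    partitions, coarse ones included, because the local equality
    implies a global Lipschitz estimate. *)
Lemma locally_linear_curve_length a b c K d : a <= b -> 0 < d ->
  (forall u v, u <= v -> v - u <= d -> mdist (c u) (c v) = K * (v - u)) ->
  curve_length a b c = (K * (b - a))%:E.
Proof.
move=> ab d0 cK; apply/eqP; rewrite eq_le; apply/andP; split.
  apply: curve_length_le => s abs; rewrite lee_fin.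
  apply: inscribed_length_le_lipschitz abs => u v uv.
  exact: locally_linear_lipschitz uv d0 cK.
have [s abs <-] := locally_linear_partition ab d0 cK.
exact: inscribed_length_le_curve_length.
Qed.

End CurveLength.

(** * Closed geodesics and their minimizing index *)

Section Geodesics.
Variables (R : realType) (M : metricType R).
Implicit Types (g : circle R -> M) (L K d : R).

Lemma circle_piD (s t : R) : circle_pi (s + t) = circle_pi s + circle_pi t.
Proof. exact: Quotient.pi_add. Qed.

Lemma circle_pi_surj (x : circle R) :
  exists2 t, 0 <= t <= 2 * pi & circle_pi t = x.
Proof.
have pi0 := pi_gt0 R; have p0 : 0 < 2 * pi :> R by lra.
pose r := repr x; pose n := Num.floor (r / (2 * pi)).
exists (r - n%:~R * (2 * pi)).
  have /andP[n1 n2] := floor_itv (r / (2 * pi)).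
  rewrite ler_pdivlMr// in n1; rewrite ltr_pdivrMr// intrD mulrDl mul1r in n2.
  by rewrite -/n in n1 n2; lra.
rewrite -[RHS]reprK; apply/eqP; rewrite /circle_pi -Quotient.idealrBE.
rewrite /in_mem/= /twopiZ addrAC subrr sub0r mulNr mulfK ?gt_eqF//.
by rewrite rpredN intr_int.
Qed.

Lemma closed_geodesic_lipschitz g L : closed_geodesic g ->
  loop_length g = L%:E -> forall u v, u <= v ->
  mdist (circle_lift g u) (circle_lift g v) <= L / (2 * pi) * (v - u).
Proof.
move=> [_ _ _ gs] gL u v uv; have := mdist_le_curve_length (circle_lift g) uv.
by rewrite gs// gL -!EFinM lee_fin.
Qed.

Lemma length_ge0 g L : closed_geodesic g -> loop_length g = L%:E -> 0 <= L.
Proof.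
move=> cg gL; have p0 : 0 < 2 * pi :> R by have := pi_gt0 R; lra.
have := closed_geodesic_lipschitz cg gL (ltW p0).
rewrite subr0 divfK ?gt_eqF//; apply: le_trans; exact: mdist_ge0.
Qed.

(** If [c] lost length between [u] and [v], the Lipschitz bound on the two
    remaining pieces could not make up for it. *)
Lemma linear_subsegment (c : R -> M) K a b :
  (forall u v, u <= v -> mdist (c u) (c v) <= K * (v - u)) ->
  mdist (c a) (c b) = K * (b - a) ->
  forall u v, a <= u -> u <= v -> v <= b -> mdist (c u) (c v) = K * (v - u).
Proof.
move=> cK cab u v au uv vb; apply/eqP; rewrite eq_le cK//=.
have h1 := metric_triangle (c a) (c u) (c b).
have h2 := metric_triangle (c u) (c v) (c b).
have h3 := cK _ _ au; have h4 := cK _ _ vb.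
rewrite cab in h1; move: h1 h2 h3 h4; rewrite !mulrBr; lra.
Qed.

(** A length minimizing curve is compared with the shortest path that the length
    space provides between its endpoints, rescaled to [[a, b]]. *)
Lemma length_minimizing_mdist (c : R -> M) a b : length_space M -> a < b ->
  length_minimizing a b c -> curve_length a b c = (mdist (c a) (c b))%:E.
Proof.
move=> lM ab cmin; apply/eqP; rewrite eq_le; apply/andP; split; last first.
  exact/mdist_le_curve_length/ltW.
have [c' [c'c c'0 c'1 _ c'l]] := lM (c a) (c b).
have ba0 : 0 < b - a by rewrite subr_gt0.
pose phi (t : R) := (t - a) / (b - a).
rewrite -c'l; apply: le_trans (curve_length_affine c' ab).
apply: cmin; rewrite ?subrr ?mul0r ?divff ?gt_eqF//.
apply/subspace_continuousP => x xab.
have phi01 y : y \in `[a, b] -> phi y \in `[0, 1].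
  rewrite !in_itv/= /phi => /andP[ay yb].
  by rewrite ler_pdivlMr// mul0r ler_pdivrMr// mul1r subr_ge0 lerD2r ay.
move/subspace_continuousP : c'c => /(_ (phi x) (phi01 _ xab)).
apply: cvg_trans => A /= A0.
have cphi : phi y @[y --> x] --> phi x.
  by apply: cvgMr_tmp; exact: (cvgB (@cvg_id _ _) (@cvg_cst _ _ _ _ _)).
suff : nbhs x [set y | y \in `[a, b] -> A (c' (phi y))] by [].
have := cphi _ A0; apply: (@filterS _ (nbhs x)) => y /= h /phi01; exact: h.
Qed.

Lemma closed_geodesic_locally_linear g L : length_space M -> closed_geodesic g ->
  loop_length g = L%:E -> forall t, exists2 e, 0 < e & forall u v,
    t - e <= u -> u <= v -> v <= t + e ->
    mdist (circle_lift g u) (circle_lift g v) = L / (2 * pi) * (v - u).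
Proof.
move=> lM cg gL t; have [_ _ /(_ t)[e e0 gmin] gs] := cg.
exists e => //; apply: linear_subsegment.
  exact: closed_geodesic_lipschitz.
have tt : t - e < t + e by lra.
have := length_minimizing_mdist lM tt gmin.
by rewrite gs ?ltW// gL -!EFinM => -[].
Qed.

(** The radius [e] of [closed_geodesic_locally_linear] depends on the point [t].
    Compactness of [[0, 2 * pi]] gives one scale [d] that works for all points,
    and any [k] with [2 * pi / k <= d] will do. *)
Lemma ex_one_over_geodesic g L : length_space M -> closed_geodesic g ->
  loop_length g = L%:E -> exists k, one_over_geodesic k g.
Proof.
move=> lM cg gL; have pi0 := pi_gt0 R; have p0 : 0 < 2 * pi :> R by lra.
pose P (d t : R) := forall s, 0 <= s -> s <= d ->
  mdist (circle_lift g t) (circle_lift g (t + s)) = L / (2 * pi) * s.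
have Pd : \forall d \near 0^'+, `[0, 2 * pi] `<=` P d.
  have /compact_near_coveringP := @segment_compact R 0 (2 * pi).
  apply => t _; have [e e0 ge] := closed_geodesic_locally_linear lM cg gL t.
  have e20 : 0 < e / 2 by rewrite divr_gt0.
  near=> t' d => s /= s0 sd.
  have : `|t - t'| < e / 2 by near: t'; exact: nbhsx_ballx.
  have : d < e / 2 by near: d; exact: nbhs_right_lt.
  rewrite ltr_norml => de /andP[t1 t2].
  have [l m r] : [/\ t - e <= t', t' <= t' + s & t' + s <= t + e].
    by split; lra.
  by rewrite ge// addrAC subrr add0r.
have [d [{}Pd d0]] : exists d, `[0, 2 * pi] `<=` P d /\ 0 < d.
  by apply: (@filter_ex _ (0 : R)^'+); apply: filterI Pd (nbhs_right_gt 0).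
pose k := (Num.truncn (2 * pi / d)).+1.
have k0 : 0 < k%:R :> R by rewrite ltr0n.
have kd : 2 * pi / k%:R <= d.
  by rewrite ler_pdivrMr// [d * _]mulrC -ler_pdivrMr// ltW// truncnS_gt.
exists k; split => // x; have [t t2pi <-] := circle_pi_surj x.
rewrite -circle_piD gL -EFinM; congr EFin.
rewrite (Pd t _ (2 * pi / k%:R))//.
- by rewrite mulrA divfK ?gt_eqF.
- by rewrite divr_ge0 ?ltW.
Unshelve. all: by end_near.
Qed.

Lemma minindP g : (exists k, one_over_geodesic k g) ->
  one_over_geodesic (minind g) g.
Proof.
move=> ex; have exb : exists k, `[< one_over_geodesic k g >].
  by have [k /asboolP gk] := ex; exists k.
suff [] : one_over_geodesic (minind g) g /\
  forall j, one_over_geodesic j g -> (minind g <= j)%N by [].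
rewrite /minind; set S := (X in xget _ X).
suff : S (xget 0%N S) by [].
case: (ex_minnP exb) => m /asboolP gm mmin.
by apply: (@xgetPex _ 0%N S); exists m; split => // j /asboolP; exact: mmin.
Qed.

(** The equality at distance exactly [2 * pi / k] extends to all smaller
    distances; the latter form is monotone in [k], so a bound on the minimizing
    index gives a scale that is common to infinitely many geodesics. *)
Lemma one_over_geodesic_linear g L k : loop_length g = L%:E ->
  one_over_geodesic k g -> forall u v, u <= v -> v - u <= 2 * pi / k%:R ->
  mdist (circle_lift g u) (circle_lift g v) = L / (2 * pi) * (v - u).
Proof.
move=> gL [k0 cg gk] u v uv vuk.
have pi0 := pi_gt0 R; have p0 : 0 < 2 * pi :> R by lra.
apply: (linear_subsegment (a := u) (b := u + 2 * pi / k%:R)) => //.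
- exact: closed_geodesic_lipschitz.
- have := gk (circle_pi u); rewrite -circle_piD gL -EFinM => -[->].
  by rewrite [u + _]addrC addrK mulrA divfK ?gt_eqF.
- lra.
Qed.

(** A converse of [closed_geodesic_locally_linear]: local distances determine all
    the data of a closed geodesic, and they are what passes to limits. *)
Lemma locally_linear_closed_geodesic g K d : 0 < K -> 0 < d ->
  (forall u v, u <= v -> v - u <= d ->
    mdist (circle_lift g u) (circle_lift g v) = K * (v - u)) ->
  closed_geodesic g /\ loop_length g = (K * (2 * pi))%:E.
Proof.
move=> K0 d0 gK; have pi0 := pi_gt0 R; have p0 : 0 < 2 * pi :> R by lra.
have gl u v (uv : u <= v) := locally_linear_curve_length uv d0 gK.
have gL : loop_length g = (K * (2 * pi))%:E.
  by rewrite /loop_length gl ?ltW// subr0.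
split=> //; split.
- move=> t; apply/metricType_numDomainType.cvgrPdist_lt => e e0.
  have glip u v (uv : u <= v) := locally_linear_lipschitz uv d0 gK.
  have eK0 : 0 < e / K by rewrite divr_gt0.
  near=> t'.
  have : `|t - t'| < e / K.
    near: t'. exact: (nbhsx_ballx (t : R) _ eK0).
  rewrite ltr_pdivlMr// mulrC; apply: le_lt_trans.
  have [tt'|/ltW tt'] := leP t t'.
    by rewrite distrC ger0_norm ?subr_ge0// glip.
  by rewrite metric_sym ger0_norm ?subr_ge0// glip.
- exists (circle_pi 0), (circle_pi d) => g0d.
  have := gK 0 d (ltW d0); rewrite subr0 => /(_ (lexx _)).
  rewrite /circle_lift g0d mdistxx => /esym/eqP.
  by rewrite gt_eqF// mulr_gt0.
- move=> t; exists (d / 2); first by rewrite divr_gt0.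
  move=> c' _ ca cb; have tt : t - d / 2 <= t + d / 2 by lra.
  rewrite gl// -gK//; last lra.
  by rewrite -ca -cb; exact: mdist_le_curve_length.
- move=> s t st; rewrite gl// gL -!EFinM; congr EFin.
  by rewrite mulfK ?gt_eqF.
Unshelve. all: by end_near.
Qed.

End Geodesics.

(** * Gromov-Hausdorff convergence and ultralimits *)

Section GromovHausdorff.
Variable R : realType.

Lemma mdist_close (Z : metricType R) (x y x' y' : Z) :
  `|mdist x y - mdist x' y'| <= mdist x x' + mdist y y'.
Proof.
rewrite ler_norml.
have h1 := metric_triangle x x' y; have h2 := metric_triangle x' y' y.
have h3 := metric_triangle x' x y'; have h4 := metric_triangle x y y'.
have e1 := metric_sym y y'; have e2 := metric_sym x x'.
by apply/andP; split; lra.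
Qed.

(** In a common ambient space, each point of [X] is sent to some point of [Y] at
    distance less than [e], which costs [e] at each end of a segment. *)
Lemma GH_dist_almost_isometry (X Y : metricType R) (e : R) :
  (GH_dist X Y < e%:E)%E ->
  exists h : X -> Y, forall x x',
    `|mdist (h x) (h x') - mdist x x'| <= 2 * e.
Proof.
move=> /ereal_inf_lt[_ [Z [f [g [fi gi ->]]]]].
move=> /ereal_inf_lt[_ [r [r0 fg _] <-]]; rewrite lte_fin => re.
have /choice[h hP] : forall x, exists y, mdist (f x) (g y) < r.
  move=> x; have [|_ [y _ <-] xy] := fg (f x); first by exists x.
  by exists y.
exists h => x x'; rewrite -fi -gi.
apply: le_trans (mdist_close _ _ _ _) _.
have := hP x; have := hP x'; rewrite ![mdist (g _) _]metric_sym; lra.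
Qed.

(** An ultrafilter decides every preimage of a neighbourhood of a cluster point,
    so that the cluster point is a limit. *)
Lemma compact_ultra_cvg (M : topologicalType) (T : Type) (U : set_system T)
    (f : T -> M) : compact [set: M] -> UltraFilter U ->
  exists q : M, f x @[x --> U] --> q.
Proof.
move=> cM UU; have [q [_ fq]] := cM (f x @[x --> U]) _ filterT.
exists q => V Vq; have [//|UV] := in_ultra_setVsetC (f @^-1` V) UU.
by have [y [ny yV]] := fq (~` V) V UV Vq.
Qed.

(** The points [q x] are chosen independently of each other: one ultrafilter
    serves all [x] at once, so [S] may be uncountable. *)
Lemma ultralimit (M : metricType R) (S T : Type) (U : set_system T)
    (p : T -> S -> M) : compact [set: M] -> UltraFilter U ->
  exists q : S -> M, forall x y,
    mdist (p i x) (p i y) @[i --> U] --> mdist (q x) (q y).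
Proof.
move=> cM UU.
have /choice[q qP] : forall x, exists q : M, p i x @[i --> U] --> q.
  by move=> x; exact: compact_ultra_cvg.
exists q => x y; apply/cvgrPdist_le => e e0.
have e2 : 0 < e / 2 by rewrite divr_gt0.
near=> i; apply: le_trans (mdist_close _ _ _ _) _.
have : mdist (q x) (p i x) < e / 2.
  by near: i; exact: metricType_numDomainType.cvgr_dist_lt (qP x) _ e2.
have : mdist (q y) (p i y) < e / 2.
  by near: i; exact: metricType_numDomainType.cvgr_dist_lt (qP y) _ e2.
lra.
Unshelve. all: by end_near.
Qed.

(** The points [x] show that [M] is inhabited, which is needed to define [h] at
    the finitely many indices where the distance is infinite. *)
Lemma GH_cvg_almost_isometries (M_ : nat -> metricType R) (M : metricType R)
    (x : forall i, M_ i) : GH_dist (M_ i) M @[i --> \oo] --> 0%E ->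
  exists (h : forall i, M_ i -> M) (eps : nat -> R),
    eps i @[i --> \oo] --> 0 /\ \forall i \near \oo,
      forall y z, `|mdist (h i y) (h i z) - mdist y z| <= eps i.
Proof.
move=> hGH; have [GHfin cGH] := (fine_cvgP _ _).1 hGH.
(* the distance itself need not be attained, hence the additional 1 / i.+1 *)
pose eps i : R := fine (GH_dist (M_ i) M) + i.+1%:R^-1.
have hex i : GH_dist (M_ i) M \is a fin_num -> exists h : M_ i -> M,
    forall y z, `|mdist (h y) (h z) - mdist y z| <= 2 * eps i.
  move=> fn; apply: GH_dist_almost_isometry.
  by rewrite -{1}(fineK fn) lte_fin /eps ltrDl invr_gt0 ltr0n.
have [m0 _] : exists m : M, True.
  have [i /hex[h _]] := filter_ex GHfin.
  by exists (h (x i)).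
have {}hex i : exists h : M_ i -> M, GH_dist (M_ i) M \is a fin_num ->
    forall y z, `|mdist (h y) (h z) - mdist y z| <= 2 * eps i.
  have [/hex[h hP]|] := pselect (GH_dist (M_ i) M \is a fin_num).
    by exists h.
  by exists (fun=> m0).
exists (fun i => sval (cid (hex i))), (fun i => 2 * eps i); split.
  rewrite -[0](mulr0 2); apply: cvgMl_tmp; rewrite -[0]addr0.
  by apply: cvgD cGH _; exact: cvg_harmonic.
by apply: filterS GHfin => i; exact: svalP (cid (hex i)).
Qed.

End GromovHausdorff.

(** * Divergence of the minimizing index *)

Theorem corollary7p2 (R : realType) (M_ : nat -> metricType R)
    (M : metricType R) (L : nat -> R) (Loo : R)
    (hM_ : forall i, compact_length_space (M_ i))
    (hM : compact [set: M])
    (hGH : GH_dist (M_ i) M @[i --> \oo] --> 0%E)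
    (hLi : forall i, length_spectrum (M_ i) (L i))
    (hL : L i @[i --> \oo] --> Loo)
    (hLoo : ~ length_spectrum M Loo)
    (hLoo0 : Loo != 0)
    (gamma : forall i, circle R -> M_ i)
    (hgamma : forall i, closed_geodesic (gamma i))
    (hlen : forall i, loop_length (gamma i) = (L i)%:E) :
  minind (gamma i) @[i --> \oo] --> \oo.
Proof.
have pi0 := pi_gt0 R; have p0 : 0 < 2 * pi :> R by lra.
apply/cvgnyPge => A; apply: contrapT => nA; apply: hLoo.
have A0 : (0 < A)%N.
  by case: A nA => // -[]; apply: nearW.
pose d : R := 2 * pi / A%:R.
have d0 : 0 < d by rewrite divr_gt0// ltr0n.
pose B := [set i | (minind (gamma i) < A)%N].
(* [B] meets every neighbourhood of infinity, by the choice of [A] *)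
have PF : ProperFilter (within B \oo).
  apply: Build_ProperFilter => BF; apply: nA; move: BF.
  by apply: (@filterS _ \oo) => i /= Bi; rewrite leqNgt; apply/negP => /Bi.
have [U [UU FU]] := ultraFilterLemma PF.
have ooU V : (\forall i \near \oo, V i) -> U V.
  by move=> Voo; apply: FU; move: Voo; apply: (@filterS _ \oo) => i Vi _.
have UB : U B by apply: FU; exact: nearW.
have glin i : B i -> forall u v, u <= v -> v - u <= d ->
    mdist (circle_lift (gamma i) u) (circle_lift (gamma i) v) =
    L i / (2 * pi) * (v - u).
  move=> Bi; have [_ lM] := hM_ i.
  have gi := minindP (ex_one_over_geodesic lM (hgamma i) (hlen i)).
  have [k0 _ _] := gi; move=> u v uv vud.
  apply: (one_over_geodesic_linear (hlen i) gi uv); apply: le_trans vud _.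
  rewrite /d ler_pM2l// lef_pV2 ?posrE ?ltr0n// ler_nat ltnW//.
have [h [eps [eps0 hP]]] := GH_cvg_almost_isometries (gamma^~ 0) hGH.
have [q qP] := ultralimit (fun i => h i \o gamma i) hM UU.
have qlin u v : u <= v -> v - u <= d ->
    mdist (circle_lift q u) (circle_lift q v) = Loo / (2 * pi) * (v - u).
  move=> uv vud.
  have cL : L i / (2 * pi) * (v - u) @[i --> U] --> Loo / (2 * pi) * (v - u).
    apply: cvgMr_tmp; apply: cvgMr_tmp => V /hL VL; exact: ooU.
  have ce : eps i @[i --> U] --> 0 by move=> V /eps0 Ve; exact: ooU.
  have cp : mdist ((h i \o gamma i) (circle_pi u))
      ((h i \o gamma i) (circle_pi v)) @[i --> U] -->
      Loo / (2 * pi) * (v - u).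
    apply/cvgrPdist_le => e e0.
    have e2 : 0 < e / 2 by rewrite divr_gt0.
    move/cvgrPdist_le : cL => /(_ _ e2) cL; move/cvgrPdist_le : ce => /(_ _ e2) ce.
    have UhP := ooU _ hP.
    near=> i.
    have Bi : B i by near: i.
    have := glin i Bi u v uv vud; rewrite /circle_lift => glini.
    have hPi : forall y z, `|mdist (h i y) (h i z) - mdist y z| <= eps i.
      by near: i.
    have := hPi (gamma i (circle_pi u)) (gamma i (circle_pi v)).
    rewrite glini /=.
    have : `|Loo / (2 * pi) * (v - u) - L i / (2 * pi) * (v - u)| <= e / 2.
      by near: i.
    have : `|0 - eps i| <= e / 2 by near: i.
    rewrite !ler_norml => /andP[a1 a2] /andP[b1 b2] /andP[c1 c2].
    by apply/andP; split; lra.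
  have PU := @ultra_proper _ _ UU.
  have cq := qP (circle_pi u) (circle_pi v).
  exact: (@cvg_unique R (@Rhausdorff R) _ _ _ _ cq cp).
have K0 : 0 < Loo / (2 * pi).
  rewrite divr_gt0// lt_neqAle eq_sym hLoo0/=.
  apply: (cvgr_to_ge hL).
  by apply: nearW => i; exact: length_ge0 (hgamma i) (hlen i).
have [qg qL] := locally_linear_closed_geodesic K0 d0 qlin.
by exists q => //; rewrite qL divfK ?gt_eqF.
Unshelve. all: by end_near.
Qed.
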